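(* Let $G=(V,E)$ be a finite, simple, undirected, connected graph, and let $p\in[1,\infty]$. Then $d_p$ is a metric on $V$. Moreover, $d_1$ is an ultrametric on $V$.
   Context: A walk $\gamma=x_0\,e_1\,x_1\cdots e_n\,x_n$ in $G$ is a string of alternating vertices and edges with $e_k=\{x_{k-1},x_k\}\in E$ for $k=1,\dots,n$ (the constant walk, $n=0$, is allowed). A simple path is a walk that does not visit any node more than once. For a walk $\gamma$ and an edge $e$, $\mathcal{N}(\gamma,e)$ denotes the number of times $\gamma$ traverses $e$ (so for a simple path it is $1$ if $e\in\gamma$ and $0$ otherwise). For $a,b\in V$, the connecting family $\Gamma(a,b)$ is the family of all simple paths in $G$ that start at $a$ and end at $b$; $\Gamma(a,a)$ consists of the constant walk. A density is a function $\rho:E\to[0,\infty)$. For a walk $\gamma$ put $\ell_\rho(\gamma)=\sum_{e\in E}\mathcal{N}(\gamma,e)\rho(e)$, and for a family of walks $\Gamma$ put $\ell_\rho(\Gamma)=\inf_{\gamma\in\Gamma}\ell_\rho(\gamma)$. The set of admissible densities is $\mathrm{Adm}(\Gamma)=\{\rho\in\mathbb{R}_{\ge0}^E:\ell_\rho(\Gamma)\ge1\}$. The $p$-energy is $\mathcal{E}_p(\rho)=\sum_{e\in E}\rho(e)^p$ if $1\le p<\infty$, and $\mathcal{E}_\infty(\rho)=\max_{e\in E}\rho(e)$. The $p$-modulus of $\Gamma$ is $\mathrm{Mod}_p(\Gamma)=\inf_{\rho\in\mathrm{Adm}(\Gamma)}\mathcal{E}_p(\rho)$, with the infimum over the empty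 set equal to $+\infty$ (thus $\mathrm{Mod}_p(\Gamma(a,a))=\infty$). Define $d_p:V\times V\to\mathbb{R}$ by $d_p(a,b)=\mathrm{Mod}_p(\Gamma(a,b))^{-1/p}$ if $1\le p<\infty$, and $d_\infty(a,b)=\mathrm{Mod}_\infty(\Gamma(a,b))^{-1}$, with the convention that a negative power of $\infty$ is $0$ (thus $d_p(a,a)=0$). A function $d:X\times X\to\mathbb{R}$ is a metric if it is non-negative, $d(a,b)=0$ iff $a=b$, symmetric, and satisfies $d(a,b)\le d(a,c)+d(c,b)$ for all $a,b,c\in X$. It is an ultrametric if the last condition is replaced by $d(a,b)\le\max\{d(a,c),d(c,b)\}$ for all $a,b,c\in X$. *)

(* Defs.v *)
From mathcomp Require Import all_boot all_order all_algebra.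
From mathcomp Require Import all_classical all_reals all_analysis.

Set Implicit Arguments.
Unset Strict Implicit.
Unset Printing Implicit Defensive.

Import Order.TTheory GRing.Theory Num.Theory.

Local Open Scope classical_set_scope.
Local Open Scope ring_scope.

Record sgraph (V : finType) := SGraph {
  edges : {set {set V}};
  edges_card2 : forall e : {set V}, e \in edges -> #|e| = 2%N
}.

Notation edge G := {e : {set _} | e \in edges G}.

Definition adj (V : finType) (G : sgraph V) : rel V :=
  fun x y => [set x; y]%SET \in edges G.

Definition connected_graph (V : finType) (G : sgraph V) : Prop :=
  forall a b : V, connect (adj G) a b.

(* The walk x_0 e_1 x_1 ... e_n x_n is stored as x_0 and [:: x_1; ...; x_n]:
   its edges are determined by e_k = {x_(k-1), x_k}. *)
Record walk (V : finType) (G : sgraph V) := Walk {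
  wsource : V;
  wsteps : seq V;
  walkP : path (adj G) wsource wsteps
}.

Definition wtarget (V : finType) (G : sgraph V) (w : walk G) : V :=
  last (wsource w) (wsteps w).

Definition wvertices (V : finType) (G : sgraph V) (w : walk G) : seq V :=
  wsource w :: wsteps w.

Definition wedges (V : finType) (G : sgraph V) (w : walk G) : seq {set V} :=
  pairmap (fun x y => [set x; y]%SET) (wsource w) (wsteps w).

Definition traversals (V : finType) (G : sgraph V) (w : walk G) (e : edge G)
  : nat := count_mem (val e) (wedges w).

Definition simple_path (V : finType) (G : sgraph V) (w : walk G) : Prop :=
  uniq (wvertices w).

Definition connecting (V : finType) (G : sgraph V) (a b : V) : set (walk G) :=
  [set w | [/\ simple_path w, wsource w = a & wtarget w = b]].
Arguments connecting {V} G a b.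

Section Modulus.
Variables (R : realType) (V : finType) (G : sgraph V).

Definition walk_length (rho : edge G -> R) (w : walk G) : R :=
  \sum_(e : edge G) (traversals w e)%:R * rho e.

Definition family_length (rho : edge G -> R) (Gamma : set (walk G)) : \bar R :=
  ereal_inf [set (walk_length rho w)%:E | w in Gamma].

Definition admissible (Gamma : set (walk G)) : set (edge G -> R) :=
  [set rho | (forall e, 0 <= rho e) /\ (1 <= family_length rho Gamma)%E].

(* The exponent ranges over [1, +oo]; the value at p = -oo is irrelevant.
   Densities are nonnegative, so starting the maximum at 0 is harmless; it
   only fixes the energy to be 0 when there are no edges. *)
Definition energy (p : \bar R) (rho : edge G -> R) : R :=
  match p with
  | r%:E => \sum_(e : edge G) rho e `^ r
  | _ => \big[Num.max/0]_(e : edge G) rho e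
  end.

Definition modulus (p : \bar R) (Gamma : set (walk G)) : \bar R :=
  ereal_inf [set (energy p rho)%:E | rho in admissible Gamma].

(* Power with a negative exponent s of x in [0, +oo], with (+oo)^s = 0.
   poweR is not used since it sets (+oo) `^ s = +oo even for s < 0. The power
   0 `^ s, which should be +oo, has the default value 0 of powR: a pair of
   distinct vertices of modulus 0 would thus violate d(a,b) = 0 -> a = b. *)
Definition neg_power (x : \bar R) (s : R) : R :=
  if x is t%:E then t `^ s else 0.

Definition mod_dist (p : \bar R) (a b : V) : R :=
  match p with
  | r%:E => neg_power (modulus p (connecting G a b)) (- (1 / r))
  | _ => neg_power (modulus p (connecting G a b)) (- 1)
  end.

End Modulus.
Arguments mod_dist {R V} G p a b.

Definition is_metric (R : realType) (X : Type) (d : X -> X -> R) : Prop :=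
  [/\ forall a b, 0 <= d a b,
      forall a b, d a b = 0 <-> a = b,
      forall a b, d a b = d b a
    & forall a b c, d a b <= d a c + d c b].

Definition is_ultrametric (R : realType) (X : Type) (d : X -> X -> R) : Prop :=
  [/\ forall a b, 0 <= d a b,
      forall a b, d a b = 0 <-> a = b,
      forall a b, d a b = d b a
    & forall a b c, d a b <= Num.max (d a c) (d c b)].

(* Main.v *)
Require Import Defs.
From mathcomp Require Import all_boot all_order all_algebra.
From mathcomp Require Import lra.
From mathcomp Require Import all_classical all_reals all_analysis.

Local Open Scope ring_scope.

(** Write [dist rho a b] for the infimum of the [rho]-lengths of the simple
paths from [a] to [b], and [pnorm p rho] for the p-norm of [rho], that is, the
p-energy to the power 1/p (the maximum of [rho] when p is infinite). Since the
energy is homogeneous, rescaling a density so that it becomes admissible shows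
that the modulus distance is an extremal length:

  d_p(a, b) = sup { dist rho a b / pnorm p rho : rho >= 0, rho <> 0 }.

The two halves of this formula are [dist_le_mod_dist] and [mod_dist_le]. Each
[dist rho] is a pseudometric, because every walk contains a simple path with
the same ends that is not longer ([simple_subwalk]). Symmetry and the triangle
inequality survive the supremum, and two distinct vertices are
separated by the density that is 1 on the edges at [a] and 0 elsewhere.

For p = 1 the norm is the sum of the density, and the supremum is attained on
indicators of cuts, as in the max-flow min-cut theorem. The form needed here
is [potential_le_cuts]: if every cut between [a] and [b] has at least 1/C
edges, then a potential whose increments are dominated by [rho] satisfies
phi(b) - phi(a) <= C * sum rho. This is the coarea formula, proved by peeling
off one sublevel set at a time. It applies to the potential phi = [dist rho a],
with C the maximum of d_1(a, c) and d_1(c, b): any cut S between [a] and [b]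
also separates [c] from one of them, and its indicator makes the distance
between the two separated vertices at least 1, whence
1 <= C * #(boundary of S). *)

(** * Distances induced by a density *)

Section Distance.
Import Order.TTheory GRing.Theory Num.Theory.
Local Open Scope classical_set_scope.
Set Implicit Arguments.
Unset Strict Implicit.
Variables (R : realType) (V : finType) (G : sgraph V).
Implicit Types (rho : edge G -> R) (a b c x y : V) (s : seq V).

Lemma adjC x y : adj G x y = adj G y x.
Proof. by rewrite /adj finset.setUC. Qed.

(** A density extended by 0 to all sets of vertices, so that the length of a
    walk becomes a plain sum over its list of edges. *)
Definition edge_weight rho (A : {set V}) : R := oapp rho 0 (insub A).

Definition steps_length rho x s : R :=
  \sum_(A <- pairmap (fun x y => [set x; y]%SET) x s) edge_weight rho A.

Lemma sum_count_edge_weight rho (r : seq {set V}) :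
  \sum_(e : edge G) (count_mem (val e) r)%:R * rho e =
  \sum_(A <- r) edge_weight rho A.
Proof.
elim: r => [|A r IHr]; first by rewrite big_nil big1 // => e _; rewrite mul0r.
rewrite big_cons -IHr.
under eq_bigr do rewrite /= natrD mulrDl.
rewrite big_split /=; congr (_ + _); rewrite /edge_weight.
case: insubP => [e Ae <-|nAe] /=.
  rewrite (bigD1 e) //= eqxx mul1r big1 ?addr0 // => f fe.
  by rewrite (inj_eq val_inj) eq_sym (negbTE fe) mul0r.
rewrite big1 // => e _; case: eqP => [Ae|]; last by rewrite mul0r.
by rewrite Ae (valP e) in nAe.
Qed.

Lemma walk_lengthE rho (w : walk G) :
  walk_length rho w = steps_length rho (wsource w) (wsteps w).
Proof. exact: sum_count_edge_weight. Qed.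

Lemma edge_weight_ge0 rho A : (forall e, 0 <= rho e) -> 0 <= edge_weight rho A.
Proof. by move=> rho0; rewrite /edge_weight; case: insub => /=. Qed.

Lemma steps_length_ge0 rho x s :
  (forall e, 0 <= rho e) -> 0 <= steps_length rho x s.
Proof. by move=> rho0; apply: sumr_ge0 => A _; exact: edge_weight_ge0. Qed.

Lemma walk_length_ge0 rho (w : walk G) :
  (forall e, 0 <= rho e) -> 0 <= walk_length rho w.
Proof. by rewrite walk_lengthE; exact: steps_length_ge0. Qed.

Lemma steps_length_nil rho x : steps_length rho x [::] = 0.
Proof. exact: big_nil. Qed.

Lemma steps_length_cons rho x y s :
  steps_length rho x (y :: s) =
  edge_weight rho [set x; y]%SET + steps_length rho y s.
Proof. exact: big_cons. Qed.

Lemma steps_length_cat rho x s t :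
  steps_length rho x (s ++ t) =
  steps_length rho x s + steps_length rho (last x s) t.
Proof. by rewrite /steps_length pairmap_cat big_cat. Qed.

Lemma steps_lengthZ rho k x s :
  steps_length (fun e => k * rho e) x s = k * steps_length rho x s.
Proof.
rewrite /steps_length mulr_sumr; apply: eq_bigr => A _.
by rewrite /edge_weight; case: insub => //=; rewrite mulr0.
Qed.

Lemma rev_steps rho x s : path (adj G) x s -> exists t,
  [/\ path (adj G) (last x s) t, last (last x s) t = x &
      steps_length rho (last x s) t = steps_length rho x s].
Proof.
elim: s x => [|y s IHs] x /=; first by move=> _; exists [::].
case/andP=> xy /IHs[t [pt lt lent]]; exists (rcons t x).
rewrite rcons_path pt lt adjC xy last_rcons; split=> //.
rewrite -cats1 steps_length_cat lent lt !steps_length_cons steps_length_nil.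
by rewrite addr0 addrC finset.setUC.
Qed.

(** Loop erasure: when the first vertex occurs again in the simple path already
    found for the rest of the walk, the part before that occurrence is dropped.
    The statement compares lengths because the vertices of the simple path alone
    would not bound its length. *)
Lemma simple_subwalk rho x s : (forall e, 0 <= rho e) -> path (adj G) x s ->
  exists t, [/\ path (adj G) x t, uniq (x :: t), last x t = last x s &
                steps_length rho x t <= steps_length rho x s].
Proof.
move=> rho0; elim: s x => [|y s IHs] x /=; first by move=> _; exists [::].
case/andP=> xy /IHs[t [pt ut lt lent]].
have [xt|xt] := boolP (x \in y :: t); last first.
  exists (y :: t); rewrite /= xy pt lt; split=> //; first by rewrite xt.
  by rewrite !steps_length_cons lerD2l.
have lenxt u v : y :: t = u ++ x :: v ->
    steps_length rho x v <= steps_length rho y t.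
  case: u => [[-> ->] //|z u [_ ->]].
  rewrite steps_length_cat steps_length_cons addrA lerDr.
  by rewrite addr_ge0 ?edge_weight_ge0 ?steps_length_ge0.
have [u [v E]] : exists u v, y :: t = u ++ x :: v.
  by case/splitPr: xt => u v; exists u, v.
exists v; split.
- have: sorted (adj G) (y :: t) by [].
  by rewrite E sorted_cat_cons => /andP[].
- by move: ut; rewrite E cat_uniq => /and3P[].
- rewrite -lt; have: last x (y :: t) = last x (u ++ x :: v) by rewrite E.
  by rewrite last_cat /= => ->.
- apply: le_trans (lenxt _ _ E) _; apply: le_trans lent _.
  by rewrite steps_length_cons lerDr edge_weight_ge0.
Qed.

Definition dist rho a b : R :=
  inf [set walk_length rho w | w in connecting G a b].

Lemma dist_le_walk rho a b w : (forall e, 0 <= rho e) ->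
  connecting G a b w -> dist rho a b <= walk_length rho w.
Proof.
move=> rho0 abw; apply: ge_inf; last by exists w.
by exists 0 => _ [v _ <-]; exact: walk_length_ge0.
Qed.

(** Arbitrary walks compete in [dist]; this and [le_dist] below make
    concatenation and reversal available without regard to simplicity. *)
Lemma dist_le_steps rho a b s : (forall e, 0 <= rho e) ->
  path (adj G) a s -> last a s = b -> dist rho a b <= steps_length rho a s.
Proof.
move=> rho0 /(simple_subwalk rho0)[t [pt ut lt lent]] sb.
apply: le_trans lent; rewrite -(walk_lengthE rho (Walk pt)).
by apply: dist_le_walk => //; split; rewrite // /wtarget /= lt.
Qed.

Lemma dist_refl_le0 rho a : (forall e, 0 <= rho e) -> dist rho a a <= 0.
Proof. by move=> rho0; rewrite -(steps_length_nil rho a) dist_le_steps. Qed.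

Lemma edge_weight_val rho (e : edge G) : edge_weight rho (val e) = rho e.
Proof. by rewrite /edge_weight valK. Qed.

Lemma dist_edge rho x y (e : edge G) : (forall e, 0 <= rho e) ->
  val e = [set x; y]%SET -> dist rho x y <= rho e.
Proof.
move=> rho0 exy; have xy : path (adj G) x [:: y].
  by rewrite /= andbT /adj -exy (valP e).
rewrite -edge_weight_val exy -[leRHS]addr0 -(steps_length_nil rho y).
by rewrite -steps_length_cons dist_le_steps.
Qed.

Hypothesis G_connected : connected_graph G.

Lemma connecting_nonempty a b : connecting G a b !=set0.
Proof.
have /connectP[s ps ->] := G_connected a b.
have [t [pt ut lt _]] := @simple_subwalk (fun=> 0) a s (fun=> lexx _) ps.
by exists (Walk pt).
Qed.

Lemma le_dist rho a b m :
  (forall s, path (adj G) a s -> last a s = b -> m <= steps_length rho a s) ->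
  m <= dist rho a b.
Proof.
move=> ms; apply: lb_le_inf => [|_ [[u s ps] [_ /= ua sb] <-]].
  by have [w abw] := connecting_nonempty a b; exists (walk_length rho w), w.
by rewrite walk_lengthE; subst u; exact: ms.
Qed.

Lemma dist_sym rho a b : (forall e, 0 <= rho e) -> dist rho a b = dist rho b a.
Proof.
move=> rho0; suff sym_le x y : dist rho x y <= dist rho y x.
  by apply/le_anti; rewrite !sym_le.
apply: le_dist => s ps <-.
by have [t [pt lt <-]] := rev_steps rho ps; exact: dist_le_steps.
Qed.

Lemma dist_triangle rho a b c : (forall e, 0 <= rho e) ->
  dist rho a b <= dist rho a c + dist rho c b.
Proof.
move=> rho0; rewrite -lerBlDl; apply: le_dist => t pt tb.
rewrite lerBlDl -lerBlDr; apply: le_dist => s ps sc.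
rewrite lerBlDr -[in leRHS]sc -steps_length_cat.
by apply: dist_le_steps => //; rewrite ?cat_path ?last_cat sc // ps.
Qed.

(** * Cuts *)

(** The indicator of the edge boundary of [S]. *)
Definition cut_density (S : {set V}) (e : edge G) : R :=
  (~~ ((val e \subset S) || (val e \subset ~: S)%SET))%:R.

Lemma cut_density_ge0 S e : 0 <= cut_density S e.
Proof. exact: ler0n. Qed.

Lemma cut_densityE S x y e : val e = [set x; y]%SET ->
  cut_density S e = ((x \in S) != (y \in S))%:R.
Proof.
rewrite /cut_density => ->; rewrite !finset.subUset !finset.sub1set !finset.inE.
by case: (x \in S); case: (y \in S).
Qed.

(** A path that leaves [S] uses an edge of its boundary. *)
Lemma dist_cut_density (S : {set V}) x y : x \in S -> y \notin S ->
  1 <= dist (cut_density S) x y.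
Proof.
move=> xS yS; apply: le_dist => s; elim: s x xS => [|z s IHs] x xS /=.
  by move=> _ xy; rewrite -xy xS in yS.
case/andP=> xz ps sy; rewrite steps_length_cons.
have [zS|zS] := boolP (z \in S).
  by rewrite ler_wpDl ?edge_weight_ge0 ?IHs //; exact: cut_density_ge0.
apply: ler_wpDr; first by apply: steps_length_ge0; exact: cut_density_ge0.
pose e : edge G := exist _ [set x; z]%SET xz.
rewrite -[X in edge_weight _ X]/(val e) edge_weight_val.
by rewrite (@cut_densityE _ x z) // xS (negbTE zS).
Qed.

Lemma edge_ends (e : edge G) : exists x y, val e = [set x; y]%SET.
Proof.
have /eqP/cards2P[x [y [_ exy]]] := edges_card2 (valP e).
by exists x, y.
Qed.

(** The coarea inequality, by induction on the number of vertices above the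
    level phi(a). Let S be the sublevel set of phi(a) and eps the gap up to the
    next value of phi. Lowering phi by eps off S and rho by eps on the boundary
    of S keeps the hypotheses, brings a new vertex down to the level phi(a),
    lowers phi(b) - phi(a) by eps and C * sum rho by eps times C * #(boundary of
    S), which is at least eps. *)
Lemma potential_le_cuts (C : R) a b : 0 <= C ->
  (forall S : {set V}, a \in S -> b \notin S ->
     1 <= C * \sum_e cut_density S e) ->
  forall rho (phi : V -> R),
  (forall e x y, val e = [set x; y]%SET -> phi y - phi x <= rho e) ->
  phi b - phi a <= C * \sum_e rho e.
Proof.
move=> C0 cuts rho phi.
have [n] := ubnP #|[set x | phi a < phi x]%SET|.
elim: n => // n IHn in rho phi *; rewrite ltnS => cardn phirho.
have [ba|ab] := lerP (phi b) (phi a).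
  apply: (@le_trans _ _ 0); first by rewrite subr_le0.
  apply/mulr_ge0/sumr_ge0 => // e _; have [x [y exy]] := edge_ends e.
  have := phirho _ _ _ exy; rewrite finset.setUC in exy.
  by have := phirho _ _ _ exy; lra.
pose S := [set x | phi x <= phi a]%SET.
have inS x : (x \in S) = (phi x <= phi a) by rewrite finset.inE.
have bS : b \notin S by rewrite inS -ltNge.
case: (@arg_minP _ _ _ b [pred x | x \notin S] phi bS) => z /= zS zmin.
have az : phi a < phi z by rewrite ltNge -inS.
pose eps := phi z - phi a.
have eps0 : 0 < eps by rewrite subr_gt0.
pose phi' x := phi x - eps * (x \notin S)%:R.
pose rho' e := rho e - eps * cut_density S e.
have aS : a \in S by rewrite inS.
have phi'a : phi' a = phi a by rewrite /phi' aS mulr0 subr0.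
have IH : phi' b - phi' a <= C * \sum_e rho' e.
  apply: IHn => [|e x y exy].
    apply: leq_trans cardn; apply/proper_card/properP; split.
      apply/fintype.subsetP => x; rewrite !finset.inE phi'a.
      move=> /lt_le_trans -> //.
      by rewrite /phi' gerBl mulr_ge0 ?(ltW eps0).
    exists z; rewrite !finset.inE // phi'a /phi' zS mulr1 /eps.
    by rewrite opprB addrCA subrr addr0 ltxx.
  have xy := phirho _ _ _ exy.
  have yx : phi x - phi y <= rho e by apply: phirho; rewrite finset.setUC.
  rewrite /rho' (cut_densityE _ exy) /phi' /eps.
  (* On an edge leaving S the increment of phi is at least eps, which is what
     keeps the lowered increment and the lowered density nonnegative. *)
  have [xS|/[dup] xS /zmin zx] := boolP (x \in S);
    have [yS|/[dup] yS /zmin zy] := boolP (y \in S) => /=; try lra.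
  by move: yS; rewrite inS; lra.
have cutS := cuts S aS bS.
move: IH; rewrite phi'a /phi' bS mulr1 /rho' sumrB -mulr_sumr mulrBr.
rewrite mulrCA => IH.
have := ler_wpM2l (ltW eps0) cutS; lra.
Qed.

End Distance.

(** * The modulus distance as an extremal length *)

Section Modulus.
Import Order.TTheory GRing.Theory Num.Theory.
Local Open Scope classical_set_scope.
Set Implicit Arguments.
Unset Strict Implicit.
Variables (R : realType) (V : finType) (G : sgraph V).
Hypothesis G_connected : connected_graph G.
Implicit Types (rho : edge G -> R) (a b c x y : V).

Variables (p : \bar R) (p1 : (1 <= p)%E).

(** The degree of homogeneity of the energy: the maximum has degree 1. With it
    the finite and infinite exponents are treated alike. *)
Definition energy_degree : R := if p is r%:E then r else 1.
Local Notation q := energy_degree.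

Lemma energy_degree_gt0 : 0 < q.
Proof.
rewrite /energy_degree; move: p1; case: p => // r.
by rewrite lee_fin; apply: lt_le_trans.
Qed.

Lemma energy_ge0 rho : 0 <= energy p rho.
Proof.
case: p => [r||]; rewrite /energy ?bigmax_ge_id //.
by apply: sumr_ge0 => e _; exact: powR_ge0.
Qed.

Lemma energyZ rho k : 0 <= k -> (forall e, 0 <= rho e) ->
  energy p (fun e => k * rho e) = k `^ q * energy p rho.
Proof.
move=> k0 rho0; rewrite /energy_degree.
have maxZ : \big[Num.max/0]_e (k * rho e) = k * \big[Num.max/0]_e rho e.
  rewrite (big_morph ( *%R k) (id1 := 0) (op1 := Num.max)) ?mulr0 //.
  by move=> x y; rewrite maxr_pMr.
case: p => [r||]; rewrite /energy ?powRr1 //.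
by rewrite mulr_sumr; apply: eq_bigr => e _; rewrite powRM.
Qed.

Lemma powR_le_energy rho e : (forall e, 0 <= rho e) ->
  rho e `^ q <= energy p rho.
Proof.
move=> rho0; rewrite /energy_degree /energy.
have le_max : rho e <= \big[Num.max/0]_e rho e by exact: le_bigmax.
case: p => [r||]; rewrite ?powRr1 //.
by rewrite (bigD1 e) //= lerDl sumr_ge0 // => f _; exact: powR_ge0.
Qed.

Lemma powR_invK (x : R) : 0 <= x -> (x `^ q) `^ q^-1 = x.
Proof.
by move=> x0; rewrite -powRrM divff ?powRr1 // gt_eqF // energy_degree_gt0.
Qed.

Definition pnorm rho : R := energy p rho `^ q^-1.

Lemma pnorm_ge0 rho : 0 <= pnorm rho.
Proof. exact: powR_ge0. Qed.

Lemma le_pnorm rho e : (forall e, 0 <= rho e) -> rho e <= pnorm rho.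
Proof.
move=> rho0; rewrite -[leLHS]powR_invK // /pnorm.
apply: ge0_ler_powR; rewrite ?nnegrE ?powR_ge0 ?energy_ge0 ?powR_le_energy //.
by rewrite invr_ge0 ltW // energy_degree_gt0.
Qed.

Lemma pnormK rho : pnorm rho `^ q = energy p rho.
Proof.
rewrite /pnorm -powRrM mulVf ?powRr1 ?energy_ge0 //.
by rewrite gt_eqF // energy_degree_gt0.
Qed.

Lemma pnormZ rho k : 0 <= k -> (forall e, 0 <= rho e) ->
  pnorm (fun e => k * rho e) = k * pnorm rho.
Proof.
move=> k0 rho0; rewrite /pnorm energyZ // powRM ?powR_ge0 ?energy_ge0 //.
by rewrite powR_invK.
Qed.

Lemma admissibleE rho a b : admissible (connecting G a b) rho <->
  (forall e, 0 <= rho e) /\ 1 <= dist rho a b.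
Proof.
rewrite /admissible /family_length /=; split=> -[rho0 len1]; split=> //.
  apply: lb_le_inf => [|_ [w abw <-]].
    have [w abw] := connecting_nonempty R G_connected a b.
    by exists (walk_length rho w), w.
  rewrite -lee_fin; apply: le_trans len1 _; apply: ereal_inf_lbound.
  by exists w.
apply: le_ereal_inf_tmp => _ [w abw <-]; rewrite lee_fin.
exact: le_trans len1 (dist_le_walk rho0 abw).
Qed.

Lemma mod_distE a b :
  mod_dist G p a b = neg_power (modulus p (connecting G a b)) (- q^-1).
Proof.
by rewrite /mod_dist /energy_degree; case: p => [r||]; rewrite ?div1r ?invr1.
Qed.

Lemma mod_dist_ge0 a b : 0 <= mod_dist G p a b.
Proof.
by rewrite mod_distE /neg_power; case: modulus => // t; exact: powR_ge0.
Qed.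

(** An admissible density has distance at least 1, hence norm at least 1/C. *)
Lemma modulus_ge (C : R) a b : 0 <= C ->
  (forall rho, (forall e, 0 <= rho e) -> dist rho a b <= C * pnorm rho) ->
  ((C^-1 `^ q)%:E <= modulus p (connecting G a b))%E.
Proof.
rewrite le_eqVlt => /predU1P[<- _|C0 distC].
  rewrite invr0 powR0 ?gt_eqF ?energy_degree_gt0 //.
  by apply: le_ereal_inf_tmp => _ [rho _ <-]; rewrite lee_fin energy_ge0.
apply: le_ereal_inf_tmp => _ [rho /admissibleE[rho0 len1] <-]; rewrite lee_fin.
rewrite -(pnormK rho); apply: ge0_ler_powR.
- by rewrite ltW // energy_degree_gt0.
- by rewrite nnegrE invr_ge0 ltW.
- by rewrite nnegrE pnorm_ge0.
by rewrite -div1r ler_pdivrMr // mulrC (le_trans len1) // distC.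
Qed.

(** The upper half of the extremal length formula. *)
Lemma mod_dist_le (C : R) a b : 0 <= C ->
  (forall rho, (forall e, 0 <= rho e) -> dist rho a b <= C * pnorm rho) ->
  mod_dist G p a b <= C.
Proof.
move=> C0 distC; rewrite mod_distE.
have := modulus_ge C0 distC.
(* For C = 0 no density is admissible, and the modulus is infinite. *)
move: C0; rewrite le_eqVlt => /predU1P[C0 _|C0].
  suff -> : modulus p (connecting G a b) = +oo%E by rewrite -C0.
  rewrite /modulus; suff -> : @admissible R _ _ (connecting G a b) = set0.
    by rewrite image_set0 ereal_inf0.
  apply/seteqP; split=> // rho /admissibleE[rho0 len1].
  by have := distC _ rho0; rewrite -C0 mul0r => /(le_trans len1); rewrite ler10.
case: modulus => [t||] /=; [|by move=> _; exact: ltW..].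
rewrite lee_fin => Ct; rewrite powRN.
have Cq : C^-1 <= t `^ q^-1.
  rewrite -[leLHS]powR_invK ?invr_ge0 ?(ltW C0) //; apply: ge0_ler_powR => //.
  - by rewrite invr_ge0 ltW // energy_degree_gt0.
  - by rewrite nnegrE powR_ge0.
  - by rewrite nnegrE (le_trans _ Ct) // powR_ge0.
rewrite -[leRHS]invrK lef_pV2 // posrE ?invr_gt0 //.
by apply: lt_le_trans Cq; rewrite invr_gt0.
Qed.

(** The lower half of the extremal length formula: dividing [rho] by
    [dist rho a b] gives an admissible density, which bounds the modulus from
    above. That the modulus is not 0, so that its negative power is not a
    default value, comes from [modulus_ge], applied with the crude bound on
    [dist] given by one fixed path. *)
Lemma dist_le_mod_dist rho a b : (forall e, 0 <= rho e) ->
  dist rho a b <= mod_dist G p a b * pnorm rho.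
Proof.
move=> rho0; have [L0|L0] := lerP (dist rho a b) 0.
  by apply: le_trans L0 _; rewrite mulr_ge0 ?mod_dist_ge0 ?pnorm_ge0.
have [w abw] := connecting_nonempty R G_connected a b.
pose C : R := \sum_e (traversals w e)%:R.
have distC r : (forall e, 0 <= r e) -> dist r a b <= C * pnorm r.
  move=> r0; apply: le_trans (dist_le_walk r0 abw) _.
  rewrite mulr_suml; apply: ler_sum => e _.
  by rewrite ler_wpM2l // le_pnorm.
have C0 : 0 < C.
  rewrite lt_def sumr_ge0 // andbT; apply/eqP => C0.
  by have := distC _ rho0; rewrite C0 mul0r leNgt L0.
have := modulus_ge (ltW C0) distC.
have : (modulus p (connecting G a b) <=
        (((dist rho a b)^-1 * pnorm rho) `^ q)%:E)%E.
  rewrite -pnormZ ?invr_ge0 ?(ltW L0) // pnormK.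
  apply: ereal_inf_lbound; exists (fun e => (dist rho a b)^-1 * rho e) => //.
  apply/admissibleE; split=> [e|].
    by rewrite mulr_ge0 ?invr_ge0 ?(ltW L0).
  apply: le_dist => // s ps sb.
  rewrite steps_lengthZ mulrC ler_pdivlMr // mul1r; exact: dist_le_steps.
rewrite mod_distE; case: modulus => [t||] //=.
rewrite !lee_fin powRN => tle tge.
have t0 : 0 < t by apply: lt_le_trans tge; rewrite powR_gt0 // invr_gt0.
have N0 : 0 <= (dist rho a b)^-1 * pnorm rho.
  by rewrite mulr_ge0 ?invr_ge0 ?pnorm_ge0 // ltW.
have : t `^ q^-1 <= (dist rho a b)^-1 * pnorm rho.
  rewrite -[leRHS]powR_invK //; apply: ge0_ler_powR => //.
  - by rewrite invr_ge0 ltW // energy_degree_gt0.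
  - by rewrite nnegrE ltW.
  - by rewrite nnegrE powR_ge0.
by rewrite ler_pdivlMl // -ler_pdivlMr ?powR_gt0 // [in leRHS]mulrC.
Qed.

(** Points are separated by the density that is 1 on the edges at [a]: every
    path from [a] to another vertex has length at least 1 for it. *)
Lemma mod_dist_metric : is_metric (mod_dist G p).
Proof.
have sym_le a b : mod_dist G p a b <= mod_dist G p b a.
  apply: mod_dist_le (mod_dist_ge0 _ _) _ => rho rho0.
  by rewrite dist_sym //; exact: dist_le_mod_dist.
split=> [|a b|a b|a b c]; first exact: mod_dist_ge0.
- split=> [ab0|<-].
    apply: contrapT => /eqP ab.
    have cut0 := @cut_density_ge0 R V G [set a]%SET.
    have := dist_le_mod_dist a b cut0; rewrite ab0 mul0r leNgt => /negP; apply.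
    apply: lt_le_trans ltr01 (dist_cut_density R G_connected _ _).
      by rewrite finset.inE.
    by rewrite finset.inE eq_sym.
  apply/le_anti; rewrite mod_dist_ge0 andbT; apply: mod_dist_le => // rho rho0.
  by rewrite mul0r dist_refl_le0.
- by apply/le_anti; rewrite !sym_le.
- apply: mod_dist_le => [|rho rho0]; first by rewrite addr_ge0 ?mod_dist_ge0.
  apply: le_trans (dist_triangle G_connected a b c rho0) _.
  by rewrite mulrDl lerD ?dist_le_mod_dist.
Qed.

End Modulus.

(** * The ultrametric inequality *)

Section Ultrametric.
Import Order.TTheory GRing.Theory Num.Theory.
Local Open Scope classical_set_scope.
Set Implicit Arguments.
Unset Strict Implicit.
Variables (R : realType) (V : finType) (G : sgraph V).
Hypothesis G_connected : connected_graph G.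

Lemma pnorm1 (rho : edge G -> R) : (forall e, 0 <= rho e) ->
  pnorm 1%:E rho = \sum_e rho e.
Proof.
move=> rho0; rewrite /pnorm invr1 powRr1 ?energy_ge0 //.
by apply: eq_bigr => e _; rewrite powRr1.
Qed.

(** By [potential_le_cuts] for the potential [dist rho a] it is enough to look
    at cuts; a cut between [a] and [b] has [c] on one of its two sides. *)
Lemma mod_dist1_ultratriangle a b c :
  mod_dist G (1%:E : \bar R) a b <=
  Num.max (mod_dist G (1%:E : \bar R) a c) (mod_dist G (1%:E : \bar R) c b).
Proof.
set C := Num.max _ _.
have C0 : 0 <= C by rewrite le_max mod_dist_ge0.
apply: mod_dist_le => // rho rho0; rewrite pnorm1 //.
have -> : dist rho a b = dist rho a b - 0 by rewrite subr0.
apply: le_trans (_ : _ <= dist rho a b - dist rho a a) _.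
  by rewrite lerD2l lerN2 dist_refl_le0.
apply: (potential_le_cuts C0) => [S aS bS|e x y exy]; last first.
  rewrite lerBlDl; apply: le_trans (dist_triangle G_connected a y x rho0) _.
  by rewrite lerD2l dist_edge.
have cut0 := @cut_density_ge0 R V G S.
rewrite -pnorm1 //; have [cS|cS] := boolP (c \in S).
  apply: le_trans (dist_cut_density R G_connected cS bS) _.
  apply: le_trans (dist_le_mod_dist G_connected _ c b cut0) _ => //.
  by rewrite ler_wpM2r ?pnorm_ge0 // le_max lexx orbT.
apply: le_trans (dist_cut_density R G_connected aS cS) _.
apply: le_trans (dist_le_mod_dist G_connected _ a c cut0) _ => //.
by rewrite ler_wpM2r ?pnorm_ge0 // le_max lexx.
Qed.

Lemma mod_dist1_ultrametric : is_ultrametric (mod_dist G (1%:E : \bar R)).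
Proof.
have [ge0 eq0 sym _] := mod_dist_metric G_connected (lexx (1%:E : \bar R)).
by split=> // a b c; exact: mod_dist1_ultratriangle.
Qed.

End Ultrametric.

Theorem theorem3p3 (R : realType) (V : finType) (G : sgraph V)
    (G_connected : connected_graph G) :
  (forall p : \bar R, (1 <= p)%E -> is_metric (mod_dist G p)) /\
  is_ultrametric (mod_dist G (1%:E : \bar R)).
Proof.
split=> [p p1|]; first exact: mod_dist_metric.
exact: mod_dist1_ultrametric.
Qed.
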